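(* Let $K$ be a non-Archimedean locally compact field of characteristic $p>0$, and let $U=1+M_K$ be its group of 1-units. Let $\Lambda$ be the set of maps $f:U\to U$ that are locally analytic on $U$ and satisfy $f(uv)=f(u)f(v)$ for all $u,v\in U$; it is a group under pointwise multiplication. Then the map $(\mathbb{Z}_p,+)\to(\Lambda,\cdot)$, $y\mapsto (u\mapsto u^y)$, is an isomorphism of groups. In particular $(\Lambda,\cdot)\cong(\mathbb{Z}_p,+)$.
   Context: $K$ has ring of integers $R_K$ with maximal ideal $M_K$, constant field $\mathbb{F}$ of order $q$, and a uniformizer $\pi$, so $K=\mathbb{F}((\pi))$ and $U=1+\pi\mathbb{F}[[\pi]]$. The absolute value is $|x|=q^{-v(x)}$. For $\alpha\in R_K$ and $t>0$, $B_{\alpha,t}=\{u\in R_K: |u-\alpha|\le t\}$. A continuous function $f$ on a ball $B_{\alpha,t}$ with $t=|\rho|$ ($\rho\in R_K$) is analytic there if $f(u)=\sum_{n\ge0}c_n\left(\frac{u-\alpha}{\rho}\right)^n$ with $c_n\in K$, $c_n\to0$. A continuous function $f:U\to K$ is locally analytic if every $\alpha\in U$ has a ball $B_{\alpha,t_\alpha}\subset U$ ($t_\alpha>0$) on which $f$ is analytic. For $y\in\mathbb{Z}_p$ and $u=1+x\in U$, $u^y=\sum_{n\ge0}\binom{y}{n}x^n$ (the natural $\mathbb{Z}_p$-module structure on $U$). *)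

(* Defs.v *)
(* K = F((pi)) for a finite field F of characteristic p. *)
From mathcomp Require Import all_boot all_order all_algebra.
Set Implicit Arguments. Unset Strict Implicit. Unset Printing Implicit Defensive.
Import Order.TTheory GRing.Theory Num.Theory.
Local Open Scope ring_scope.

Section LocalField.
Variable F : finFieldType.

(* ---------- R_K = F[[pi]] : power series as coefficient functions ---------- *)
Definition ps := nat -> F.
Definition ps_zero : ps := fun _ => 0.
Definition ps_one : ps := fun k => (k == 0%N)%:R.
Definition ps_pi : ps := fun k => (k == 1%N)%:R.
Definition ps_add (a b : ps) : ps := fun k => a k + b k.
Definition ps_sub (a b : ps) : ps := fun k => a k - b k.
Definition ps_mul (a b : ps) : ps :=
  fun k => \sum_(i < k.+1) a i * b (k - i)%N.
Fixpoint ps_pow (a : ps) (n : nat) : ps :=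
  if n is n'.+1 then ps_mul a (ps_pow a n') else ps_one.

(* a = b mod pi^m, i.e. |a - b| <= q^{-m} *)
Definition ps_eqmod (m : nat) (a b : ps) : Prop := forall k, (k < m)%N -> a k = b k.

Definition in_U (u : ps) : Prop := u 0%N = 1.

(* ---------- K = F((pi)) : Laurent series  pi^lval * (sum_j lcoef j pi^j) ---- *)
Record laurent := Laurent { lval : int; lcoef : ps }.
Definition coefL (c : laurent) (k : int) : F :=
  if (lval c <= k)%R then lcoef c `|k - lval c|%N else 0.
Definition embed (t : ps) : laurent := Laurent 0 t.
Definition lterm (c : laurent) (w : ps) (n : nat) : laurent :=
  Laurent (lval c) (ps_mul (lcoef c) (ps_pow w n)).

Definition lconv0 (c : nat -> laurent) : Prop :=
  forall m : int, exists N0, forall n, (N0 <= n)%N ->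
    forall k : int, (k < m)%R -> coefL (c n) k = 0.

Definition lseries_to (c : nat -> laurent) (w : ps) (t : ps) : Prop :=
  forall m : int, exists N0, forall N, (N0 <= N)%N ->
    forall k : int, (k < m)%R ->
      \sum_(n < N) coefL (lterm (c n) w n) k = coefL (embed t) k.

(* u in B_{alpha,|rho|}, i.e. |u - alpha| <= |rho|  (rho divides u - alpha) *)
Definition in_ball (alpha rho u : ps) : Prop :=
  exists w, ps_sub u alpha = ps_mul rho w.

(* f analytic on B_{alpha,|rho|}:  f u = sum_n c_n ((u - alpha)/rho)^n, c_n -> 0 *)
Definition analytic_on (f : ps -> ps) (alpha rho : ps) : Prop :=
  exists c : nat -> laurent, lconv0 c /\
    forall u w, ps_sub u alpha = ps_mul rho w -> lseries_to c w (f u).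

Definition continuous_on_U (f : ps -> ps) : Prop :=
  forall u, in_U u -> forall m, exists m', forall v, in_U v ->
    ps_eqmod m' u v -> ps_eqmod m (f u) (f v).

Definition locally_analytic (f : ps -> ps) : Prop :=
  continuous_on_U f /\
  forall alpha, in_U alpha -> exists rho, rho <> ps_zero /\
    (forall u, in_ball alpha rho u -> in_U u) /\ analytic_on f alpha rho.

Definition in_Lambda (f : ps -> ps) : Prop :=
  (forall u, in_U u -> in_U (f u)) /\
  (forall u v, in_U u -> in_U v -> f (ps_mul u v) = ps_mul (f u) (f v)) /\
  locally_analytic f.

(* ---------- Z_p as compatible residues y n in [0, p^n) ---------- *)
Definition is_Zp (p : nat) (y : nat -> nat) : Prop :=
  forall n, (y n < p ^ n)%N /\ (y n.+1 %% p ^ n)%N = y n.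
Definition padic_add (p : nat) (y z : nat -> nat) : nat -> nat :=
  fun n => ((y n + z n) %% p ^ n)%N.

(* image in F (of char p) of binom(y, n) in Z_p: equals 'C(y_k, n) mod p for any
   k with p^k > n (Lucas); we take k = n+1 *)
Definition binomF (y : nat -> nat) (n : nat) : F := ('C(y n.+1, n))%:R.

(* u^y = sum_n binom(y,n) (u-1)^n ; since u - 1 in pi R_K, the coefficient of pi^k
   only receives contributions from n <= k *)
Definition zp_pow (y : nat -> nat) (u : ps) : ps :=
  fun k => \sum_(n < k.+1) binomF y n * ps_pow (ps_sub u ps_one) n k.

End LocalField.

(* Main.v *)
(* Let f be in Lambda. Shrinking a ball around 1 clears denominators: there are
   s <> 0 and a_i in F[[pi]] with f (1 + s x) = sum_i a_i x^i for all x in the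
   maximal ideal. Suppose f (1 + s x) = (1 + s x)^y + d x^n + O(x^(n+1)).
   Comparing f (u^p) with f(u)^p gives d^p = d (s^n)^(p-1), so d = j s^n with
   0 <= j < p. If n is not a power of p, comparing f (uv) with f(u) f(v) for
   u = 1 + s t, v = 1 + s t pi and t -> 0 gives
   d ((1 + pi)^n - 1 - pi^n) = 0, so d = 0. Hence agreement to order p^k with
   exponent y_k improves to agreement to order p^(k+1) with exponent
   y_k + j p^k, and in the limit f (u) = u^y near 1. For arbitrary u in U,
   u^(p^k) is near 1 for large k, and the Frobenius map is injective. *)
From HB Require Import structures.
Require Import Defs.
From mathcomp Require Import all_boot all_order all_algebra.
From mathcomp Require Import boolp ring zify.

Set Implicit Arguments. Unset Strict Implicit. Unset Printing Implicit Defensive.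
Import Order.TTheory GRing.Theory Num.Theory.
Local Open Scope ring_scope.

(** * The integral domain F[[pi]] *)

Section PowerSeriesRing.
Variable F : finFieldType.
Implicit Types a b c : ps F.

Definition ps_opp a : ps F := fun k => - a k.

Lemma ps_addA : associative (@ps_add F).
Proof. by move=> a b c; apply/funext => k; rewrite /ps_add addrA. Qed.

Lemma ps_addC : commutative (@ps_add F).
Proof. by move=> a b; apply/funext => k; rewrite /ps_add addrC. Qed.

Lemma ps_add0 : left_id (@ps_zero F) (@ps_add F).
Proof. by move=> a; apply/funext => k; rewrite /ps_add add0r. Qed.

Lemma ps_addN : left_inverse (@ps_zero F) ps_opp (@ps_add F).
Proof. by move=> a; apply/funext => k; rewrite /ps_add addNr. Qed.

(** Coefficient [k] of a product involves only coefficients of index at most [k], so truncation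
    transports ring laws from [{poly F}] to [ps F]. *)
Lemma ps_mul_coefM (p q : {poly F}) a b k :
  (forall i, (i <= k)%N -> p`_i = a i) -> (forall i, (i <= k)%N -> q`_i = b i) ->
  (p * q)`_k = ps_mul a b k.
Proof.
move=> pa qb; rewrite coefM; apply: eq_bigr => i _.
by rewrite pa ?qb ?leq_subr // -ltnS.
Qed.

Lemma coef_trunc a n i : (i <= n)%N -> (\poly_(j < n.+1) a j)`_i = a i.
Proof. by move=> le_in; rewrite coef_poly ltnS le_in. Qed.

Lemma ps_mulA : associative (@ps_mul F).
Proof.
move=> a b c; apply/funext => k.
pose t x := \poly_(j < k.+1) (x : ps F) j.
have tE x i : (i <= k)%N -> (t x)`_i = x i by exact: coef_trunc.
have tM x y i : (i <= k)%N -> (t x * t y)`_i = ps_mul x y i.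
  by move=> le_ik; apply: ps_mul_coefM => j le_ji; apply: tE; apply: leq_trans le_ik.
rewrite -(@ps_mul_coefM (t a) (t b * t c)) => [|i /tE //|i /tM //].
by rewrite -(@ps_mul_coefM (t a * t b) (t c)) ?mulrA => // [i /tM //|i /tE].
Qed.

Lemma ps_mulC : commutative (@ps_mul F).
Proof.
move=> a b; apply/funext => k.
have t x := @coef_trunc x k.
by rewrite -(ps_mul_coefM (t a) (t b)) -(ps_mul_coefM (t b) (t a)) mulrC.
Qed.

Lemma ps_mul1 : left_id (@ps_one F) (@ps_mul F).
Proof.
move=> a; apply/funext => k; rewrite /ps_mul big_ord_recl /= subn0 mul1r big1 ?addr0 //.
by move=> i _; rewrite mul0r.
Qed.

Lemma ps_mulD : left_distributive (@ps_mul F) (@ps_add F).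
Proof.
move=> a b c; apply/funext => k; rewrite /ps_mul /ps_add -big_split /=.
by apply: eq_bigr => i _; rewrite mulrDl.
Qed.

HB.instance Definition _ := gen_eqMixin (ps F).
HB.instance Definition _ := gen_choiceMixin (ps F).
HB.instance Definition _ := GRing.isZmodule.Build (ps F) ps_addA ps_addC ps_add0 ps_addN.

Lemma ps_one_neq0 : (@ps_one F : ps F) != 0.
Proof. by apply/eqP => /(congr1 (fun a : ps F => a 0%N))/eqP; rewrite oner_eq0. Qed.

HB.instance Definition _ := GRing.Zmodule_isComNzRing.Build (ps F)
  ps_mulA ps_mulC ps_mul1 ps_mulD ps_one_neq0.

Lemma ps_mulE a b : ps_mul a b = a * b. Proof. by []. Qed.

Lemma ps_powE a n : ps_pow a n = a ^+ n.
Proof. by elim: n => //= n ->; rewrite exprS. Qed.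

Lemma coefps0 k : (0 : ps F) k = 0. Proof. by []. Qed.
Lemma coefps1 k : (1 : ps F) k = (k == 0%N)%:R. Proof. by []. Qed.
Lemma coefpsD a b k : (a + b) k = a k + b k. Proof. by []. Qed.
Lemma coefpsN a k : (- a) k = - a k. Proof. by []. Qed.
Lemma coefpsM a b k : (a * b) k = \sum_(i < k.+1) a i * b (k - i)%N. Proof. by []. Qed.

Lemma coefpsM0 a b : (a * b) 0%N = a 0%N * b 0%N.
Proof. by rewrite coefpsM big_ord_recl big_ord0 addr0. Qed.

Lemma coefpsX0 a n : (a ^+ n) 0%N = a 0%N ^+ n.
Proof. by elim: n => // n IH; rewrite !exprS coefpsM0 IH. Qed.

Lemma coefps_natr n k : (n%:R : ps F) k = (k == 0%N)%:R *+ n.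
Proof. by elim: n => // n IH; rewrite !mulrSr coefpsD IH. Qed.

Lemma coefps_natrM n a k : (n%:R * a) k = n%:R * a k.
Proof.
rewrite mulr_natl; elim: n => [|n IH]; first by rewrite mul0r.
by rewrite mulrS coefpsD IH -add1n natrD mulrDl mul1r.
Qed.

Lemma coefps_sum n (a_ : nat -> ps F) k : (\sum_(i < n) a_ i) k = \sum_(i < n) a_ i k.
Proof. by elim: n => [|n IH]; rewrite ?big_ord0 // !big_ord_recr /= -IH. Qed.

Local Notation pi := (ps_pi F).

Lemma coefps_piXM n a k : (pi ^+ n * a) k = if (k < n)%N then 0 else a (k - n)%N.
Proof.
elim: n k => [|n IH] k; first by rewrite expr0 mul1r subn0.
rewrite exprS -mulrA coefpsM; case: k => [|k].
  by rewrite big_ord_recl big_ord0 mul0r addr0.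
rewrite 2!big_ord_recl big1 => [|i _]; last by rewrite mul0r.
by rewrite mul0r add0r mul1r addr0 /bump /= !subSS subn0 IH ltnS.
Qed.

Lemma ps_eq0 a : (forall k, a k = 0) -> a = 0.
Proof. by move=> a0; apply/funext. Qed.

Lemma ps_pi_factor a n : (forall k, (k < n)%N -> a k = 0) -> a = pi ^+ n * (fun k => a (n + k)%N).
Proof.
move=> a0; apply/funext => k; rewrite coefps_piXM; case: ltnP => [/a0//|le_nk].
by rewrite subnKC.
Qed.

Lemma ps_neq0_factor a : a != 0 -> exists n (b : ps F), a = pi ^+ n * b /\ b 0%N != 0.
Proof.
move=> a_neq0; have [k ak] : exists k, a k != 0.
  apply: contrapT => /forallNP a0; case/eqP: a_neq0; apply: ps_eq0 => k.
  by apply/eqP/negPn/negP/a0.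
case: (@ex_minnP (fun k => a k != 0)); first by exists k.
move=> n an n_min; exists n, (fun j => a (n + j)%N); split; last by rewrite addn0.
apply: ps_pi_factor => j lt_jn; apply/eqP/negPn; apply/negP => /n_min.
by rewrite leqNgt lt_jn.
Qed.

(** The lowest nonzero coefficients of the two factors multiply to a nonzero coefficient of the
    product. *)
Lemma ps_integral a b : a * b = 0 -> (a == 0) || (b == 0).
Proof.
apply: contra_eqT; rewrite negb_or => /andP[/ps_neq0_factor[m [a' [-> a0]]]].
move=> /ps_neq0_factor[n [b' [-> b0]]]; apply/eqP => /(congr1 (fun c : ps F => c (m + n)%N)).
rewrite mulrACA -exprD coefps_piXM ltnn subnn coefpsM0 => /eqP.
by rewrite mulf_eq0 (negPf a0) (negPf b0).
Qed.

(** Invertibility is bare existence and the inverse is chosen classically; [ps_unitE] later shows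
    that a nonzero constant coefficient suffices. *)
Definition ps_unit : pred (ps F) := fun a => `[< exists b, b * a = 1 >].

Definition ps_inv a : ps F :=
  if pselect (exists b, b * a = 1) is left ex then sval (cid ex) else a.

Lemma ps_mulV : {in ps_unit, left_inverse 1 ps_inv *%R}.
Proof.
move=> a /asboolP ua; rewrite /ps_inv; case: pselect => // ex.
exact: (svalP (cid ex)).
Qed.

Lemma ps_unitP a b : b * a = 1 -> ps_unit a.
Proof. by move=> ba; apply/asboolP; exists b. Qed.

Lemma ps_inv_out : {in [predC ps_unit], ps_inv =1 id}.
Proof.
by move=> a /asboolP ua; rewrite /ps_inv; case: pselect.
Qed.

HB.instance Definition _ := GRing.ComNzRing_hasMulInverse.Build (ps F)
  ps_mulV ps_unitP ps_inv_out.
HB.instance Definition _ := GRing.ComUnitRing_isIntegral.Build (ps F) ps_integral.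

Lemma pchar_ps p : p \in [pchar F] -> p \in [pchar ps F].
Proof.
move=> /andP[/= p_pr /eqP p0]; rewrite inE p_pr /=; apply/eqP/ps_eq0 => k.
by rewrite coefps_natr -mulr_natl p0 mul0r.
Qed.

End PowerSeriesRing.

Local Notation pi := (ps_pi _).

(** * Divisibility in F[[pi]] and evaluation of series on the maximal ideal *)

Section Congruence.
Variable F : finFieldType.
Implicit Types a b c x : ps F.

(** The divisor is arbitrary, not only a power of [pi], because the later estimates O(x^n) are
    relative to a variable [x]. *)
Definition dvps x a := exists r, a = x * r.

Lemma dvpsD x a b : dvps x a -> dvps x b -> dvps x (a + b).
Proof. by move=> [r ->] [s ->]; exists (r + s); rewrite mulrDr. Qed.

Lemma dvpsN x a : dvps x a -> dvps x (- a).
Proof. by move=> [r ->]; exists (- r); rewrite mulrN. Qed.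

Lemma dvpsB x a b : dvps x a -> dvps x b -> dvps x (a - b).
Proof. by move=> xa xb; apply: dvpsD => //; apply: dvpsN. Qed.

Lemma dvpsMl x a b : dvps x a -> dvps x (b * a).
Proof. by move=> [r ->]; exists (b * r); rewrite mulrCA. Qed.

Lemma dvpsMr x a b : dvps x a -> dvps x (a * b).
Proof. by move=> xa; rewrite mulrC; apply: dvpsMl. Qed.

Lemma dvps_refl x : dvps x x.
Proof. by exists 1; rewrite mulr1. Qed.

Lemma dvps_trans x a b : dvps x a -> dvps a b -> dvps x b.
Proof. by move=> xa [r ->]; apply: dvpsMr. Qed.

Lemma dvps_expl x m n : (m <= n)%N -> dvps (x ^+ m) (x ^+ n).
Proof. by move=> le_mn; exists (x ^+ (n - m)); rewrite -exprD subnKC. Qed.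

Lemma dvps_expr x a n : dvps x a -> dvps (x ^+ n) (a ^+ n).
Proof. by move=> [r ->]; exists (r ^+ n); rewrite exprMn. Qed.

Lemma dvps_subX x a b n : dvps x (a - b) -> dvps x (a ^+ n - b ^+ n).
Proof. by move=> xab; rewrite subrXX; apply: dvpsMr. Qed.

Lemma ps_eqmodP m a b : ps_eqmod m a b <-> dvps (pi ^+ m) (a - b).
Proof.
split=> [ab|[r /eqP]].
  exists (fun k => (a - b) (m + k)%N); apply: ps_pi_factor => k lt_km.
  by rewrite coefpsD coefpsN ab // subrr.
rewrite subr_eq => /eqP -> k lt_km.
by rewrite coefpsD coefps_piXM lt_km add0r.
Qed.

Lemma dvps_pi x : x 0%N = 0 <-> dvps pi x.
Proof.
split=> [x0|[r ->]]; last by rewrite coefpsM0 mul0r.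
by exists (fun k => x (1 + k)%N); rewrite -[X in X * _]expr1; apply: ps_pi_factor => -[].
Qed.

(** Asking only for arbitrarily large [m] lets the sequence [p ^ k] serve as moduli. *)
Lemma ps_sep a : (forall n, exists2 m, (n <= m)%N & dvps (pi ^+ m) a) -> a = 0.
Proof.
move=> aN; apply: ps_eq0 => k; have [m lt_km am] := aN k.+1.
by have /ps_eqmodP-> : dvps (pi ^+ m) (a - 0) by rewrite subr0.
Qed.

Lemma ps_eq_mod a b : (forall n, exists2 m, (n <= m)%N & dvps (pi ^+ m) (a - b)) -> a = b.
Proof. by move/ps_sep/eqP; rewrite subr_eq0 => /eqP. Qed.

(** This replaces letting [x] tend to 0: the positive powers of [pi] are among the admissible
    [x]. *)
Lemma dvps_all_eq0 a : (forall x, x 0%N = 0 -> x != 0 -> dvps x a) -> a = 0.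
Proof.
move=> aN; apply: ps_sep => n; exists n.+1 => //; apply: aN.
  by rewrite exprS coefpsM0 mul0r.
by rewrite expf_neq0 //; apply/eqP => /(congr1 (fun c : ps F => c 1%N))/eqP; rewrite oner_eq0.
Qed.

Lemma in_U_sub1 (u : ps F) : in_U u <-> (u - 1) 0%N = 0.
Proof.
rewrite /in_U coefpsD coefpsN coefps1; split=> [->|/eqP]; first by rewrite subrr.
by rewrite subr_eq0 => /eqP.
Qed.

(* The value at [x] in the maximal ideal of the power series with coefficients
   [a]: the terms of index > k do not contribute to the coefficient of pi^k. *)
Definition psum (a : nat -> ps F) x : ps F := fun k => \sum_(i < k.+1) (a i * x ^+ i) k.

Lemma psum_partial (a : nat -> ps F) x n : x 0%N = 0 -> dvps (pi ^+ n) (psum a x - \sum_(i < n) a i * x ^+ i).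
Proof.
move=> /dvps_pi px; apply/ps_eqmodP => k lt_kn.
rewrite (coefps_sum n (fun i => a i * x ^+ i)) /psum -(big_mkord xpredT (fun i => (a i * x ^+ i) k)).
rewrite -(big_mkord xpredT (fun i => (a i * x ^+ i) k)) [RHS](@big_cat_nat _ _ _ k.+1) //=.
rewrite [X in _ + X]big_nat_cond [X in _ + X]big1 ?addr0 // => i /andP[/andP[lt_ki _] _].
have : dvps (pi ^+ i) (a i * x ^+ i - 0) by rewrite subr0; apply/dvpsMl/dvps_expr.
by move=> /ps_eqmodP ->.
Qed.

(** Partial sums of lengths [n + m] and [m] are compared modulo [pi ^+ m] for every [m]. The
    remainder appears as an explicit multiple of [x ^+ n]. *)
Lemma psum_taylor (a : nat -> ps F) x n : x 0%N = 0 ->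
  psum a x = \sum_(i < n) a i * x ^+ i + x ^+ n * psum (fun i => a (n + i)%N) x.
Proof.
move=> x0; apply: ps_eq_mod => m; exists m => //.
have := psum_partial a (n + m) x0; have := psum_partial (fun i => a (n + i)%N) m x0.
rewrite big_split_ord /=.
have -> : \sum_(i < m) a (n + i)%N * x ^+ (n + i) = x ^+ n * \sum_(i < m) a (n + i)%N * x ^+ i.
  by rewrite mulr_sumr; apply: eq_bigr => i _; rewrite exprD mulrCA.
set S := \sum_(_ < n) _; set Q := \sum_(_ < m) _; set P := psum (fun i => _) x => d1 d2.
have -> : psum a x - (S + x ^+ n * P) = psum a x - (S + x ^+ n * Q) - x ^+ n * (P - Q) by ring.
apply: dvpsB; last exact: dvpsMl.
exact: dvps_trans (dvps_expl _ (leq_addl _ _)) d2.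
Qed.

(** After scaling to constant term 1, [u] becomes [1 - x] with [x] in the maximal ideal, and the
    geometric series inverts it. *)
Lemma ps_unitE (u : ps F) : u 0%N != 0 -> exists v, u * v = 1.
Proof.
move=> u0; pose c : ps F := fun k => if k == 0%N then (u 0%N)^-1 else 0.
pose x := 1 - c * u; have x0 : x 0%N = 0.
  by rewrite /x coefpsD coefpsN coefps1 coefpsM0 mulVf ?subrr.
exists (c * psum (fun=> 1) x).
have cu : c * u = 1 - x by rewrite /x opprB addrCA subrr addr0.
rewrite mulrCA mulrA cu; have := psum_taylor (fun=> 1) 1 x0.
rewrite big_ord_recl big_ord0 addr0 mulr1 expr1.
by set s := psum _ _ => e; rewrite mulrBl mul1r {1}e addrK.
Qed.

Lemma dvps_pi_pow (s : ps F) : s != 0 -> exists n, dvps s (pi ^+ n).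
Proof.
move=> /ps_neq0_factor[n [b [-> /ps_unitE[v bv]]]]; exists n, v.
by rewrite -mulrA bv mulr1.
Qed.

End Congruence.

(** * Powers of 1-units in characteristic p *)

Section ZpPower.
Variables (F : finFieldType) (p : nat).
Hypothesis hp : prime p.
Hypothesis hF : p \in [pchar F].
Implicit Types (a b u v x z : ps F) (y : nat -> nat).

Lemma frobeniusD k a b : (a + b) ^+ (p ^ k) = a ^+ (p ^ k) + b ^+ (p ^ k).
Proof.
apply: exprDn_pchar; rewrite pnatX; apply/orP; left.
by rewrite pnatE // pchar_ps.
Qed.

Lemma frobenius_inj k : injective (fun a => a ^+ (p ^ k)).
Proof.
move=> a b /= ab; apply/eqP; rewrite -subr_eq0; have := frobeniusD k (a - b) b.
rewrite subrK ab => /eqP; rewrite -subr_eq subrr eq_sym expf_eq0.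
by case/andP.
Qed.

Lemma natr_ps_eq m n : m%:R = n%:R :> F -> m%:R = n%:R :> ps F.
Proof.
by move=> mn; apply/funext => k; rewrite !coefps_natr -mulr_natr mn mulr_natr.
Qed.

Lemma one_unitX_mod u k : in_U u -> dvps (pi ^+ (p ^ k)) (u ^+ (p ^ k) - 1).
Proof.
move=> /in_U_sub1/dvps_pi; set x := u - 1 => px.
by rewrite -[u](subrK 1) frobeniusD expr1n addrK; apply: dvps_expr.
Qed.

Lemma one_unitX_modn u k n : in_U u -> dvps (pi ^+ (p ^ k)) (u ^+ n - u ^+ (n %% p ^ k)).
Proof.
move=> uU; rewrite {1}(divn_eq n (p ^ k)) exprD -{2}[u ^+ (n %% _)]mul1r -mulrBl.
apply: dvpsMr; rewrite mulnC exprM -[X in _ - X](expr1n _ (n %/ p ^ k)).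
by apply: dvps_subX; apply: one_unitX_mod.
Qed.

Lemma one_unitX_congr u k m n : in_U u -> m = n %[mod p ^ k] ->
  dvps (pi ^+ (p ^ k)) (u ^+ m - u ^+ n).
Proof.
move=> uU mn; rewrite -(subrK (u ^+ (m %% p ^ k)) (u ^+ m)) -addrA.
apply: dvpsD; first exact: one_unitX_modn.
by rewrite mn -opprB; apply/dvpsN/one_unitX_modn.
Qed.

Lemma in_U_1pi : in_U (1 + pi : ps F).
Proof. by rewrite /in_U coefpsD addr0. Qed.

(** Powers of [1 + pi] are generating functions of binomial coefficients mod [p], so congruences
    between such powers become facts about binomials. *)
Lemma coef_1piX n k : ((1 + pi : ps F) ^+ n) k = 'C(n, k)%:R.
Proof.
elim: n k => [|n IH] k; first by rewrite expr0 coefps1 bin0n.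
rewrite exprS mulrDl mul1r coefpsD -[pi]expr1 coefps_piXM expr1 !IH.
by case: k => [|k]; rewrite ?bin0 ?addr0 // binS natrD subn1.
Qed.

Lemma bin_congr m n k i : (i < p ^ k)%N -> m = n %[mod p ^ k] ->
  'C(m, i)%:R = 'C(n, i)%:R :> F.
Proof.
move=> lt_i mn; rewrite -!coef_1piX.
by have /ps_eqmodP := one_unitX_congr in_U_1pi mn; apply.
Qed.

Lemma expr1D_mod z m : dvps (z ^+ 2) ((1 + z) ^+ m - 1 - m%:R * z).
Proof.
elim: m => [|m [r rE]]; first by exists 0; rewrite expr0; ring.
exists (r + m%:R + z * r); rewrite exprS.
move/eqP: rE; rewrite !subr_eq => /eqP ->; rewrite -natr1; ring.
Qed.

(** Write n = p^v m with m prime to [p]: then (1 + pi)^n = (1 + pi^(p^v))^m, whose coefficient at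
    p^v is m. *)
Lemma bin_pval_neq0 n : (0 < n)%N -> 'C(n, p ^ logn p n)%:R != 0 :> F.
Proof.
move=> n_gt0; have [m pm nE] := pfactor_coprime hp n_gt0; set v := logn p n in nE *.
rewrite -coef_1piX {1}nE mulnC exprM frobeniusD expr1n.
have pv : (0 < p ^ v)%N by rewrite expn_gt0 prime_gt0.
have := expr1D_mod (pi ^+ (p ^ v) : ps F) m.
rewrite -addrA -opprD -exprM => /ps_eqmodP->; last by rewrite muln2 -addnn -addn1 leq_add2l.
rewrite coefpsD coefps1 coefps_natrM -[pi ^+ (p ^ v)]mulr1 coefps_piXM ltnn subnn.
rewrite -[(p ^ v == 0)%N]negbK -lt0n pv add0r coefps1 mulr1.
by rewrite -(dvdn_pcharf hF) -prime_coprime.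
Qed.

Lemma expr1D_sum x m n : (m < n)%N -> (1 + x) ^+ m = \sum_(i < n) 'C(m, i)%:R * x ^+ i.
Proof.
move=> lt_mn; rewrite exprDn.
rewrite -(big_mkord xpredT (fun i => 'C(m, i)%:R * x ^+ i)) (@big_cat_nat _ _ _ m.+1) //=.
rewrite [X in _ + X]big_nat_cond [X in _ + X]big1 ?addr0 => [|i /andP[/andP[lt_mi _] _]].
  by rewrite big_mkord; apply: eq_bigr => i _; rewrite expr1n mul1r mulr_natl.
by rewrite bin_small // mul0r.
Qed.

Lemma Zp_modn y m n : is_Zp p y -> (m <= n)%N -> (y n %% p ^ m)%N = y m.
Proof.
move=> yP /subnKC <-; elim: (n - m)%N => [|d IH].
  by rewrite addn0 modn_small //; case: (yP m).
have [_ e] := yP (m + d)%N; rewrite addnS -IH -e modn_dvdm //.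
by rewrite dvdn_exp2l // leq_addr.
Qed.

Lemma zp_powE y u : zp_pow y u = psum (fun n => 'C(y n.+1, n)%:R) (u - 1).
Proof.
apply/funext => k; apply: eq_bigr => i _.
by rewrite ps_powE coefps_natrM.
Qed.

(** This reduces the laws of [zp_pow] to those of natural exponents, by passing to the limit in
    [k]. *)
Lemma zp_pow_mod y u k : is_Zp p y -> in_U u ->
  dvps (pi ^+ (p ^ k)) (zp_pow y u - u ^+ y k).
Proof.
move=> yP uU; rewrite zp_powE; have [yk _] := yP k.
have -> : u ^+ y k = \sum_(i < p ^ k) 'C(y i.+1, i)%:R * (u - 1) ^+ i.
  rewrite -{1}(subrK 1 u) addrC (expr1D_sum _ yk); apply: eq_bigr => i _; congr (_ * _).
  (* The series reads [y] at level [i.+1] and the power reads it at level [k]. The two residues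
     agree at the smaller level, and [i] is below [p] to that level. *)
  apply/natr_ps_eq; case: (leqP k i.+1) => [le_ki|/ltnW le_ik].
    by apply: (@bin_congr _ _ k) => //; rewrite (Zp_modn yP le_ki) modn_small.
  apply: (@bin_congr _ _ i.+1); last by rewrite (Zp_modn yP le_ik) (Zp_modn yP (leqnn _)).
  by rewrite ltnW // ltn_expl // prime_gt1.
by apply: psum_partial; apply/in_U_sub1.
Qed.

Lemma leq_expp n : (n <= p ^ n)%N.
Proof. by rewrite ltnW // ltn_expl // prime_gt1. Qed.

Lemma ps_eq_modp a b : (forall k, dvps (pi ^+ (p ^ k)) (a - b)) -> a = b.
Proof. by move=> ab; apply: ps_eq_mod => n; exists (p ^ n)%N => //; apply: leq_expp. Qed.

Lemma dvps_subM x a b a' b' : dvps x (a - a') -> dvps x (b - b') ->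
  dvps x (a * b - a' * b').
Proof.
move=> xa xb; have -> : a * b - a' * b' = (a - a') * b + a' * (b - b') by ring.
by apply: dvpsD; [apply: dvpsMr | apply: dvpsMl].
Qed.

Lemma dvps_sub_trans x b a c : dvps x (a - b) -> dvps x (b - c) -> dvps x (a - c).
Proof. by move=> ab bc; rewrite -(subrK b a) -addrA; apply: dvpsD. Qed.

Lemma dvps_subC x a b : dvps x (a - b) -> dvps x (b - a).
Proof. by move=> ab; rewrite -opprB; apply: dvpsN. Qed.

Lemma in_U_dvps u : in_U u <-> dvps pi (u - 1).
Proof. by split=> [/in_U_sub1/dvps_pi|/dvps_pi/in_U_sub1]. Qed.

Lemma in_UM u v : in_U u -> in_U v -> in_U (u * v).
Proof. by rewrite /in_U coefpsM0 => -> ->; rewrite mul1r. Qed.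

Lemma in_UX u n : in_U u -> in_U (u ^+ n).
Proof. by rewrite /in_U coefpsX0 => ->; rewrite expr1n. Qed.

Lemma zp_pow_in_U y u : is_Zp p y -> in_U u -> in_U (zp_pow y u).
Proof.
move=> yP uU; apply/in_U_dvps; have := zp_pow_mod 0 yP uU.
by have [] := yP 0%N; rewrite expn0 ltnS leqn0 => /eqP ->.
Qed.

Lemma zp_powM y u v : is_Zp p y -> in_U u -> in_U v ->
  zp_pow y (u * v) = zp_pow y u * zp_pow y v.
Proof.
move=> yP uU vU; apply: ps_eq_modp => k.
apply: dvps_sub_trans (zp_pow_mod k yP (in_UM uU vU)) _.
by rewrite exprMn; apply: dvps_subC; apply: dvps_subM; apply: zp_pow_mod.
Qed.

Lemma zp_powX y u n : is_Zp p y -> in_U u -> zp_pow y (u ^+ n) = zp_pow y u ^+ n.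
Proof.
move=> yP uU; apply: ps_eq_modp => k.
apply: dvps_sub_trans (zp_pow_mod k yP (in_UX n uU)) _.
by rewrite -exprM mulnC exprM; apply: dvps_subC; apply: dvps_subX; apply: zp_pow_mod.
Qed.

Lemma is_Zp_add y y' : is_Zp p y -> is_Zp p y' -> is_Zp p (padic_add p y y').
Proof.
move=> yP y'P n; rewrite /padic_add ltn_mod expn_gt0 prime_gt0 //; split=> //.
rewrite modn_dvdm ?dvdn_exp2l // -modnDm.
by have [_ ->] := yP n; have [_ ->] := y'P n.
Qed.

Lemma zp_powD y y' u : is_Zp p y -> is_Zp p y' -> in_U u ->
  zp_pow (padic_add p y y') u = zp_pow y u * zp_pow y' u.
Proof.
move=> yP y'P uU; apply: ps_eq_modp => k.
apply: dvps_sub_trans (zp_pow_mod k (is_Zp_add yP y'P) uU) _.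
apply: (@dvps_sub_trans _ (u ^+ (y k + y' k))).
  by apply: one_unitX_congr => //; rewrite modn_mod.
by rewrite exprD; apply: dvps_subC; apply: dvps_subM; apply: zp_pow_mod.
Qed.

(** If [y k < y' k], their difference [n] gives (1 + pi)^n = 1 modulo pi^(p^k). This contradicts the
    nonzero coefficient of index p^v, v the valuation of [n], since p^v <= n < p^k. *)
Lemma zp_pow_inj_le y y' k : is_Zp p y -> is_Zp p y' ->
  zp_pow y (1 + pi : ps F) = zp_pow y' (1 + pi) -> (y k <= y' k)%N -> y k = y' k.
Proof.
move=> yP y'P e le_k; apply/eqP; rewrite eqn_leq le_k leqNgt; apply/negP => lt_k.
set n := (y' k - y k)%N; have n_gt0 : (0 < n)%N by rewrite subn_gt0.
have [lt_k' _] := y'P k.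
have [v vE] : exists v, (1 + pi : ps F) ^+ y k * v = 1.
  by apply: ps_unitE; rewrite in_UX ?oner_eq0 //; apply: in_U_1pi.
have d : dvps (pi ^+ (p ^ k)) ((1 + pi : ps F) ^+ n - 1).
  have -> : (1 + pi : ps F) ^+ n - 1 = v * ((1 + pi) ^+ y' k - (1 + pi) ^+ y k).
    by rewrite -(subnKC le_k) exprD mulrBr mulrA ![v * _]mulrC vE mul1r.
  apply: dvpsMl; apply: dvps_sub_trans (zp_pow_mod k yP in_U_1pi); rewrite e.
  exact/dvps_subC/zp_pow_mod/in_U_1pi.
have /negP := bin_pval_neq0 n_gt0; apply; rewrite -coef_1piX.
have lt_v : (p ^ logn p n < p ^ k)%N.
  apply: leq_ltn_trans (leq_ltn_trans (leq_subr (y k) _) lt_k').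
  by apply: dvdn_leq => //; apply: pfactor_dvdnn.
have /ps_eqmodP-> // := d.
by rewrite coefps1 expn_eq0 -leqn0 leqNgt prime_gt0.
Qed.

Lemma zp_pow_inj y y' : is_Zp p y -> is_Zp p y' ->
  zp_pow y (1 + pi : ps F) = zp_pow y' (1 + pi) -> y = y'.
Proof.
move=> yP y'P e; apply/funext => k; case/orP: (leq_total (y k) (y' k)).
  exact: zp_pow_inj_le.
by move=> le_k; apply/esym/zp_pow_inj_le.
Qed.

Lemma zp_pow_continuous y : is_Zp p y -> continuous_on_U (zp_pow (F := F) y).
Proof.
move=> yP u uU m; exists (p ^ m)%N => v vU /ps_eqmodP uv; apply/ps_eqmodP.
apply: dvps_trans (dvps_expl _ (leq_expp m)) _.
apply: dvps_sub_trans (zp_pow_mod m yP uU) _.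
apply: dvps_sub_trans (dvps_subX _ uv) _.
exact/dvps_subC/zp_pow_mod.
Qed.

(** With [v] the inverse of [u], a point [u + pi * w] equals [u * (1 + pi * v * w)]. By
    multiplicativity the binomial series at 1, scaled by [zp_pow y u], is the expansion at [u]. *)
Lemma zp_pow_analytic y u : is_Zp p y -> in_U u -> analytic_on (zp_pow (F := F) y) u pi.
Proof.
move=> yP uU; have [v uv] : exists v, u * v = 1 by apply: ps_unitE; rewrite uU oner_eq0.
have vU : in_U v.
  by rewrite /in_U -[RHS](congr1 (fun a : ps F => a 0%N) uv) coefpsM0 uU mul1r.
pose a n : ps F := zp_pow y u * ('C(y n.+1, n)%:R * (pi * v) ^+ n).
exists (fun n => Laurent 0 (a n)); split.
  move=> m; exists `|m|%N => n le_mn k lt_km; rewrite /coefL /=; case: ifP => // k_ge0.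
  have /ps_eqmodP : dvps (pi ^+ n) (a n - 0).
    by rewrite subr0; do 2!apply: dvpsMl; rewrite exprMn; apply: dvpsMr; apply: dvps_refl.
  apply; lia.
move=> u' w u'E m; exists `|m|%N => n le_mn k lt_km; rewrite /coefL /=.
case: ifP => [k_ge0|_]; last by rewrite big1.
set x := pi * v * w; have x0 : x 0%N = 0 by rewrite /x !coefpsM0 !mul0r.
have -> : u' = u * (1 + x).
  by rewrite mulrDr mulr1 /x mulrA [pi * v]mulrC mulrA uv mul1r -[pi * w]u'E addrC subrK.
have xU : in_U (1 + x) by apply/in_U_sub1; rewrite addrC addrA addNr add0r.
rewrite zp_powM //.
have d : dvps (pi ^+ n) (zp_pow y u * zp_pow y (1 + x) - \sum_(i < n) a i * w ^+ i).
  have -> : \sum_(i < n) a i * w ^+ i = zp_pow y u * \sum_(i < n) 'C(y i.+1, i)%:R * x ^+ i.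
    by rewrite mulr_sumr; apply: eq_bigr => i _; rewrite /x [in RHS]exprMn /a; ring.
  rewrite -mulrBr; apply: dvpsMl; rewrite zp_powE.
  have -> : 1 + x - 1 = x by ring.
  exact: psum_partial.
have /ps_eqmodP-> := d; last by lia.
rewrite (coefps_sum n (fun i => a i * w ^+ i)); apply: eq_bigr => i _.
by rewrite ps_powE.
Qed.

Lemma zp_pow_Lambda y : is_Zp p y -> in_Lambda (zp_pow (F := F) y).
Proof.
move=> yP; split; first by move=> u; apply: zp_pow_in_U.
split; first by move=> u v; apply: zp_powM.
split; first exact: zp_pow_continuous.
move=> u uU; exists pi; split.
  by move=> /(congr1 (fun a : ps F => a 1%N))/eqP; rewrite oner_eq0.
split; last exact: zp_pow_analytic.
move=> v [w e]; apply/in_U_dvps; rewrite -(subrK u v) -addrA; apply: dvpsD.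
  by exists w.
exact/in_U_dvps.
Qed.

End ZpPower.

(** * Power series expansion of an analytic function at 1 *)

Section AnalyticExpansion.
Variable F : finFieldType.

Lemma coefL_piX (l : int) (t : ps F) n k :
  coefL (Laurent l (pi ^+ n * t)) k = coefL (Laurent (l + n%:Z) t) k.
Proof.
rewrite /coefL /= coefps_piXM.
by do 3?[case: ifP => ?]; rewrite //; try lia; congr (t _); lia.
Qed.

Lemma coefL_embed (t : ps F) (k : nat) : coefL (embed t) k = t k.
Proof. by rewrite /coefL /=; congr (t _); lia. Qed.

(** A pole of order at most [n] is cleared by [pi ^+ n]. Either [lval c] already shows this bound,
    or the first coefficients of [lcoef c] vanish and are factored out. *)
Lemma coefL_clear (c : laurent F) n (t : ps F) (k : nat) :
  (forall j : int, j < - n%:Z -> coefL c j = 0) ->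
  coefL (Laurent (lval c) (lcoef c * (pi ^+ n * t))) k =
  (((fun j : nat => coefL c (j%:Z - n%:Z)) : ps F) * t) k.
Proof.
case: c => l a /= c0; set b : ps F := fun j : nat => _.
rewrite mulrCA; have [le_ln|lt_ln] := lerP 0 (l + n%:Z).
  have -> : b = pi ^+ `|(l + n%:Z)%R|%N * a.
    apply/funext => j; rewrite coefps_piXM /b /coefL /=.
    by do 2!case: ifP => ? //; try lia; congr (a _); lia.
  rewrite coefL_piX -mulrA coefps_piXM /coefL /=.
  by do 2!case: ifP => ? //; try lia; congr ((a * t) _); lia.
have -> : a = pi ^+ `|(l + n%:Z)%R|%N * b.
  apply/funext => j; rewrite coefps_piXM /b /coefL /=.
  case: ifP => [lt_j|ge_j].
    have := c0 (l + j%:Z); rewrite /coefL /=; case: ifP; last by lia.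
    have -> : `|(l + j%:Z - l)%R|%N = j by lia.
    by move=> _; apply; lia.
  by case: ifP => ? //; try lia; congr (a _); lia.
rewrite -mulrA mulrA -exprD coefL_piX.
have -> : l + (n + `|(l + n%:Z)%R|)%N%:Z = 0 by lia.
exact: coefL_embed.
Qed.

Lemma analytic_on_psum (f : ps F -> ps F) (rho : ps F) : rho != 0 -> analytic_on f 1 rho ->
  exists (s : ps F) (a : nat -> ps F), s != 0 /\ forall x : ps F, x 0%N = 0 -> f (1 + s * x) = psum a x.
Proof.
move=> rho0 [c [c_cvg fE]].
have [N0 cN0] := c_cvg 0.
(* From index [N0] on the coefficients are integral; [V] bounds the poles of the earlier ones. Hence
   the pole of [c n] has order at most [V * n] for n > 0, and rescaling the variable by [pi ^+ V]
   clears it. *)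
pose V := (\sum_(i < N0) `|lval (c i)|)%N.
have c0 n (k : int) : k < - (V * n)%N%:Z -> coefL (c n) k = 0.
  case: n => [|n] lt_k; last first.
    have [le_n|lt_n] := leqP N0 n.+1; first by apply: cN0 => //; lia.
    have le_V : (`|lval (c n.+1)| <= V)%N.
      by rewrite /V (bigD1 (Ordinal lt_n)) //= leq_addr.
    by rewrite /coefL; case: ifP => // ?; nia.
  (* For index 0 rescaling gives nothing; but at [w = 0] the series reduces to [c 0], which is
     therefore the integral value [f 1]. *)
  have [|N1 fN1] := fE 1 0 _ 0; first by change (1 - 1 = rho * 0); rewrite mulr0 subrr.
  have := fN1 N1.+1 (leqnSn _) k; rewrite big_ord_recl big1 => [|i _]; last first.
    by rewrite /lterm ps_powE /= exprS mul0r ps_mulE mulr0 /coefL; case: ifP.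
  have lt_k0 : k < 0 by lia.
  rewrite addr0 /lterm ps_mulE mulr1 => /(_ lt_k0); case: (c 0%N) => l a /= ->.
  by rewrite /coefL /=; case: ifP => //; lia.
exists (rho * pi ^+ V), (fun n j => coefL (c n) (j%:Z - (V * n)%N%:Z)); split.
  rewrite mulf_neq0 // expf_neq0 //.
  by apply/eqP => /(congr1 (fun a : ps F => a 1%N))/eqP; rewrite oner_eq0.
move=> x x0; apply/funext => k.
have [|N1 fN1] := fE (1 + rho * pi ^+ V * x) (pi ^+ V * x) _ k.+1%:Z.
  by change (1 + rho * pi ^+ V * x - 1 = rho * (pi ^+ V * x)); ring.
(* This length is large enough both for the convergence of the given series and for [psum_partial]
   at coefficient [k]. *)
set N := (N1 + k.+1)%N; rewrite -coefL_embed -(fN1 N) ?leq_addr //; last by lia.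
set a : nat -> ps F := (fun n : nat => _); have /ps_eqmodP-> := psum_partial a N x0; last by rewrite /N; lia.
rewrite (coefps_sum N (fun i => a i * x ^+ i)); apply: eq_bigr => i _.
by rewrite /lterm ps_powE exprMn -exprM; apply: coefL_clear => j; apply: c0.
Qed.

Lemma expr1D_psum (s x : ps F) m : x 0%N = 0 ->
  (1 + s * x) ^+ m = psum (fun i => 'C(m, i)%:R * s ^+ i) x.
Proof.
move=> x0; apply: ps_eq_mod => n; exists (n + m.+1)%N; first exact: leq_addr.
have lt_m : (m < n + m.+1)%N by lia.
rewrite (expr1D_sum _ lt_m); apply: dvps_subC.
rewrite (eq_bigr (fun i : 'I__ => 'C(m, i)%:R * s ^+ i * x ^+ i)); first exact: psum_partial.
by move=> i _; rewrite exprMn mulrA.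
Qed.

Lemma psumB (a b : nat -> ps F) x : psum a x - psum b x = psum (fun i => a i - b i) x.
Proof.
apply/funext => k; rewrite coefpsD coefpsN -sumrB; apply: eq_bigr => i _.
by rewrite mulrBl.
Qed.

Lemma dvps_cancel (x b : ps F) n : x != 0 -> dvps (x ^+ n.+1) (x ^+ n * b) -> dvps x b.
Proof.
move=> x0 [r]; rewrite exprSr -mulrA => /mulfI; rewrite expf_neq0 // => /(_ isT) ->.
by exists r.
Qed.

(** The coefficients do not depend on [x]. Inductively, once those below [m < n] vanish, [b m] is
    divisible by every nonzero [x] in the maximal ideal, hence is 0. *)
Lemma psum_lead (b : nat -> ps F) n :
  (forall x : ps F, x 0%N = 0 -> dvps (x ^+ n) (psum b x)) ->
  forall x : ps F, x 0%N = 0 -> dvps (x ^+ n.+1) (psum b x - b n * x ^+ n).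
Proof.
move=> bn.
have lead m : (forall i, (i < m)%N -> b i = 0) ->
    forall x : ps F, x 0%N = 0 -> dvps (x ^+ m.+1) (psum b x - b m * x ^+ m).
  move=> b0 x x0; rewrite (psum_taylor b m.+1 x0) big_ord_recr big1 /= => [|i _].
    by rewrite add0r addrAC subrr add0r; apply/dvpsMr/dvps_refl.
  by rewrite b0 // mul0r.
have b0 m : forall i, (i < m)%N -> (i < n)%N -> b i = 0.
  elim: m => // m IH i; rewrite ltnS leq_eqVlt => /orP[/eqP-> lt_mn|]; last exact: IH.
  apply: dvps_all_eq0 => x x0 x_neq0; apply: (@dvps_cancel x _ m) => //.
  rewrite mulrC; have -> : b m * x ^+ m = psum b x - (psum b x - b m * x ^+ m) by ring.
  apply: dvpsB; first by apply: dvps_trans (bn _ x0); apply: dvps_expl.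
  by apply: lead => // j lt_jm; apply: IH => //; apply: ltn_trans lt_mn.
by apply: lead => i lt_in; exact: (b0 n).
Qed.

End AnalyticExpansion.

(** * Analytic endomorphisms near 1 *)

Section Endomorphism.
Variables (F : finFieldType) (p : nat).
Hypothesis hp : prime p.
Hypothesis hF : p \in [pchar F].

(** The polynomial X^p - t^(p-1) X has the [p] distinct roots [j t] for [0 <= j < p]; another root
    [d] would exceed its degree. *)
Lemma pchar_root (R : idomainType) (d t : R) : p \in [pchar R] -> t != 0 ->
  d ^+ p = d * t ^+ p.-1 -> exists2 j, (j < p)%N & d = j%:R * t.
Proof.
move=> pR t0 dp.
pose rs := [seq j%:R * t | j <- iota 0 p].
have [/mapP[j]|d_rs] := boolP (d \in rs).
  by rewrite mem_iota add0n => /andP[_ lt_jp] ->; exists j.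
pose P : {poly R} := 'X^p - (t ^+ p.-1)%:P * 'X.
have szP : size P = p.+1.
  rewrite size_polyDl size_polyXn // size_polyN.
  apply: leq_ltn_trans (size_polyMleq _ _) _; rewrite size_polyX addn2 /=.
  by apply: leq_ltn_trans (prime_gt1 hp); rewrite size_polyC; case: (_ != 0).
have rootP x : x ^+ p = x * t ^+ p.-1 -> root P x.
  by move=> xp; rewrite /root !hornerE xp mulrC subrr.
have := @max_poly_roots _ P (d :: rs).
rewrite szP /= size_map size_iota ltnn => H; suff: false by [].
apply: H.
- by rewrite -size_poly_eq0 szP.
- rewrite rootP //=; apply/allP => _ /mapP[j _ ->]; apply: rootP.
  rewrite exprMn -mulrA -exprS prednK ?prime_gt0 //; congr (_ * _).
  exact: pFrobenius_aut_nat.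
rewrite d_rs map_inj_in_uniq ?iota_uniq // => i j; rewrite !mem_iota !add0n /= => lt_i lt_j.
move=> /(mulIf t0)/eqP; wlog le_ij : i j lt_i lt_j / (i <= j)%N.
  move=> W; case/orP: (leq_total i j) => le; first exact: W.
  by rewrite eq_sym => /W -> .
rewrite eq_sym -subr_eq0 -natrB // -(dvdn_pcharf pR) => /dvdnP[[|q]] e; nia.
Qed.

Variables (f : ps F -> ps F) (s : ps F) (a : nat -> ps F).
Hypothesis fU : forall u, in_U u -> in_U (f u).
Hypothesis fM : forall u v, in_U u -> in_U v -> f (u * v) = f u * f v.
Hypothesis s0 : s != 0.
Hypothesis fE : forall x : ps F, x 0%N = 0 -> f (1 + s * x) = psum a x.

Lemma endo1 : f 1 = 1.
Proof.
have U1 : in_U (1 : ps F) by [].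
have f1 : f 1 != 0.
  by apply/eqP => f10; have /eqP := fU U1; rewrite f10 eq_sym oner_eq0.
by apply: (mulfI f1); rewrite -fM // !mulr1.
Qed.

Lemma endoX u n : in_U u -> f (u ^+ n) = f u ^+ n.
Proof.
move=> uU; elim: n => [|n IH]; first by rewrite !expr0 endo1.
by rewrite !exprS fM ?IH //; apply: in_UX.
Qed.

Lemma in_U_1D (x : ps F) : x 0%N = 0 -> in_U (1 + s * x).
Proof. by move=> x0; rewrite /in_U coefpsD coefpsM0 x0 mulr0 addr0. Qed.

(** Divisibility for every [x] in the maximal ideal stands for equality of the expansions in [x]
    below order [n], without mentioning coefficients. *)
Definition agrees n y := forall x : ps F, x 0%N = 0 ->
  dvps (x ^+ n) (f (1 + s * x) - (1 + s * x) ^+ y).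

Definition leading n y (d : ps F) := forall x : ps F, x 0%N = 0 ->
  dvps (x ^+ n.+1) (f (1 + s * x) - (1 + s * x) ^+ y - d * x ^+ n).

Lemma agrees_leading n y : agrees n y -> exists d, leading n y d.
Proof.
pose b i := a i - 'C(y, i)%:R * s ^+ i.
have bE (x : ps F) : x 0%N = 0 -> f (1 + s * x) - (1 + s * x) ^+ y = psum b x.
  by move=> x0; rewrite fE // expr1D_psum // psumB.
move=> fn; exists (b n) => x x0; rewrite bE //; apply: psum_lead => // z z0.
by rewrite -bE //; apply: fn.
Qed.

(* Compare f (u ^ p) with f u ^ p. *)
Lemma leading_frobenius n y d : leading n y d -> exists2 j, (j < p)%N & d = j%:R * s ^+ n.
Proof.
move=> fd; apply: pchar_root; [exact: pchar_ps | by rewrite expf_neq0 |].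
apply/eqP; rewrite -subr_eq0; apply/eqP; apply: dvps_all_eq0 => x x0 x_neq0.
(* The new argument is chosen so that [1 + s * (s ^+ p.-1 * x ^+ p)] is the [p]-th power of
   [1 + s * x]. *)
have x'0 : (s ^+ p.-1 * x ^+ p) 0%N = 0.
  by rewrite coefpsM0 [X in _ * X]coefpsX0 x0 expr0n eqn0Ngt prime_gt0 ?mulr0.
have frob u v : (u + v : ps F) ^+ p = u ^+ p + v ^+ p.
  by have := frobeniusD hp hF 1 u v; rewrite expn1.
have xE : 1 + s * (s ^+ p.-1 * x ^+ p) = (1 + s * x) ^+ p.
  by rewrite frob expr1n mulrA -exprS prednK ?prime_gt0 // exprMn.
have [r1 e1] := fd _ x0; have [r2] := fd _ x'0; rewrite xE (endoX _ (in_U_1D x0)) => e2.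
set u := 1 + s * x in e1 e2; set v := f u in e1 e2.
have vE : v = x ^+ n.+1 * r1 + d * x ^+ n + u ^+ y by rewrite -e1; ring.
pose X := (x ^+ n) ^+ p; pose S := (s ^+ n) ^+ p.-1.
have vp : v ^+ p = X * x ^+ p * r1 ^+ p + d ^+ p * X + (u ^+ y) ^+ p.
  by rewrite vE !frob !exprMn exprSr exprMn.
have {}e2 : v ^+ p - (u ^+ y) ^+ p - d * (S * X) = S * X * (s ^+ p.-1 * x ^+ p) * r2.
  by rewrite /S /X -exprM mulnC exprM [(s ^+ n) ^+ _]exprAC [(x ^+ n) ^+ _]exprAC -exprMn e2 exprSr.
apply: (@dvps_cancel _ _ _ (n * p)) => //; rewrite exprSr exprM -/X -/S.
have -> : X * (d ^+ p - d * S) = v ^+ p - (u ^+ y) ^+ p - d * (S * X) - X * x ^+ p * r1 ^+ p.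
  by rewrite vp; ring.
(* Writing [p] as [p.-1.+1] exposes a factor [x] in [x ^+ p]; this also produces the [p.-1.+1.-1] in
   the witness. *)
rewrite e2 -(prednK (prime_gt0 hp)) exprS.
exists (S * (s ^+ p.-1.+1.-1 * x ^+ p.-1) * r2 - x ^+ p.-1 * r1 ^+ p.-1.+1); rewrite /=; ring.
Qed.

(* Compare f at (1 + s t) (1 + s t pi) with the product of its values. *)
Lemma leading_not_ppower n y d : (0 < n)%N -> (p ^ logn p n < n)%N -> agrees n y ->
  leading n y d -> d = 0.
Proof.
move=> n_gt0 lt_n fn fd.
(* The second factor is nonzero: at index p^v, with v the valuation of [n] and 0 < p^v < n, its
   coefficient is a binomial prime to [p]. *)
suff /eqP : d * ((1 + pi) ^+ n - 1 - pi ^+ n) = 0.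
  rewrite mulf_eq0 => /orP[/eqP //|/eqP/(congr1 (fun a : ps F => a (p ^ logn p n)%N))].
  rewrite !coefpsD !coefpsN coef_1piX coefps1 -[pi ^+ n]mulr1 coefps_piXM lt_n coefps0.
  rewrite subr0 expn_eq0 -leqn0 leqNgt prime_gt0 //= subr0 => /eqP.
  by rewrite (negPf (bin_pval_neq0 hp hF n_gt0)).
apply: dvps_all_eq0 => t t0 t_neq0; apply: (@dvps_cancel _ _ _ n) => //.
have t'0 : (t * pi) 0%N = 0 by rewrite coefpsM0 t0 mul0r.
(* [q] is defined so that [1 + s * (t * q)] is the product of [1 + s * t] and [1 + s * (t * pi)];
   modulo [t] it is [1 + pi]. *)
pose q : ps F := 1 + pi + s * t * pi.
have tq0 : (t * q) 0%N = 0 by rewrite coefpsM0 t0 mul0r.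
have [r1 e1] := fd _ t0; have [r2 e2] := fd _ t'0; have [r3 e3] := fd _ tq0.
have uvE : 1 + s * (t * q) = (1 + s * t) * (1 + s * (t * pi)) by rewrite /q; ring.
have [r6 e6] : dvps t (q ^+ n - (1 + pi) ^+ n).
  by apply: dvps_subX; exists (s * pi); rewrite /q; ring.
have [r4 e4] : dvps t ((1 + s * t) ^+ y - 1).
  by rewrite -[X in _ - X](expr1n _ y); apply: dvps_subX; exists s; ring.
have [r5 e5] : dvps t ((1 + s * (t * pi)) ^+ y - 1).
  by rewrite -[X in _ - X](expr1n _ y); apply: dvps_subX; exists (s * pi); ring.
move: e3; rewrite uvE (fM (in_U_1D t0) (in_U_1D t'0)) exprMn.
set f1 := f _ in e1 *; set f2 := f _ in e2 *.
set A := (1 + s * t) ^+ y in e1 e4 *; set B := _ ^+ y in e2 e5 *.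
rewrite !exprMn in e2 *.
set Q := q ^+ n in e6 *; set Q' := (1 + pi) ^+ n in e6 *; set W := pi ^+ n in e2 *.
(* Since [n > 0], one factor [t] can be split off [t ^+ n], which makes the product of the two
   leading terms visibly divisible by [t ^+ n.+1]. *)
pose T := t ^+ n.-1; have tn : t ^+ n = t * T by rewrite /T -exprS prednK.
rewrite [t ^+ n.+1]exprS tn in e1 e2 *.
set r2' := pi ^+ n.+1 * r2; set r3' := q ^+ n.+1 * r3 => e3.
have f1E : f1 = A + t * T * (d + t * r1).
  by move/eqP: e1; rewrite !subr_eq => /eqP ->; ring.
have f2E : f2 = B + t * T * (d * W + t * r2').
  by move/eqP: e2; rewrite !subr_eq => /eqP ->; rewrite /r2'; ring.
have AE : A = 1 + t * r4 by rewrite -e4; ring.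
have BE : B = 1 + t * r5 by rewrite -e5; ring.
have Q'E : Q' = Q - t * r6 by rewrite -e6; ring.
(* The summands collect the errors: [A] and [B] against 1, the three remainders, the product of the
   two leading terms, and [q ^+ n] against [(1 + pi) ^+ n]. *)
exists (r4 * (d * W + t * r2') + r2' + r5 * (d + t * r1) + r1
  + T * (d + t * r1) * (d * W + t * r2') - r3' - d * r6).
have -> : t * T * (d * (Q' - 1 - W)) = A * (t * T * (d * W + t * r2'))
    + B * (t * T * (d + t * r1)) + t * T * (d + t * r1) * (t * T * (d * W + t * r2'))
    - (f1 * f2 - A * B - d * (t * T * Q)) - t * T * d * (t * r6) - t * T * d - t * T * d * W.
  by rewrite f1E f2E Q'E; ring.
rewrite e3 AE BE /r3'; ring.
Qed.

Lemma agreesS n y : leading n y 0 -> agrees n.+1 y.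
Proof. by move=> fd x x0; have := fd x x0; rewrite mul0r subr0. Qed.

Lemma agrees_1 : agrees 1 0.
Proof.
move=> x x0; rewrite expr0.
have a0 : (1 : ps F) = a 0%N.
  have := fE (erefl : (0 : ps F) 0%N = 0); rewrite mulr0 addr0 endo1.
  by rewrite (psum_taylor a 1 erefl) expr1 mul0r addr0 big_ord_recl big_ord0 addr0 mulr1.
rewrite fE // (psum_taylor a 1 x0) big_ord_recl big_ord0 addr0 mulr1 -a0 addrC addKr.
exact/dvpsMr/dvps_refl.
Qed.

(** Raising the exponent by j p^k multiplies by (1 + z)^j with z = (s x)^(p^k). Its first-order term
    [j z] is exactly the leading discrepancy. *)
Lemma agrees_digit k y : agrees (p ^ k) y ->
  exists2 j, (j < p)%N & agrees (p ^ k).+1 (y + j * p ^ k).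
Proof.
move=> fn; have [d fd] := agrees_leading fn; have [j lt_jp dE] := leading_frobenius fd.
exists j => // x x0; set n := (p ^ k)%N in fd dE *.
have n_gt0 : (0 < n)%N by rewrite expn_gt0 prime_gt0.
set z := (s * x) ^+ n; set A := (1 + s * x) ^+ y.
have -> : (1 + s * x) ^+ (y + j * n) = A * (1 + z) ^+ j.
  by rewrite exprD mulnC exprM frobeniusD // expr1n.
have := fd x x0; set g := f _ => fx.
have dx : d * x ^+ n = j%:R * z by rewrite dE /z exprMn mulrA.
(* Three errors remain: the remainder of the leading term, [A - 1] divisible by [x], and terms of
   order [z ^+ 2], which suffice because 2n >= n + 1. *)
have -> : g - A * (1 + z) ^+ j = (g - A - d * x ^+ n) - j%:R * z * (A - 1)
    - A * ((1 + z) ^+ j - 1 - j%:R * z) by rewrite dx; ring.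
have xz : dvps (x ^+ n) z by rewrite /z exprMn; apply/dvpsMl/dvps_refl.
apply: dvpsB; first apply: dvpsB => //.
  have [r rE] : dvps x (A - 1).
    by rewrite -[X in _ - X](expr1n _ y); apply: dvps_subX; exists s; ring.
  have [w ->] := xz; rewrite rE exprSr; exists (j%:R * w * r); ring.
apply: dvpsMl; apply: dvps_trans (expr1D_mod _ _).
apply: dvps_trans (dvps_expr 2 xz); rewrite -exprM; apply: dvps_expl; lia.
Qed.

(** No order strictly between p^k and p^(k+1) is a power of [p], so after the digit at p^k the
    exponent stays unchanged up to p^(k+1). *)
Lemma agrees_step k y : agrees (p ^ k) y ->
  exists2 j, (j < p)%N & agrees (p ^ k.+1) (y + j * p ^ k).
Proof.
move=> /agrees_digit[j lt_jp fj]; exists j => //; set y' := (y + _)%N in fj *.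
suff H m : (p ^ k < m <= p ^ k.+1)%N -> agrees m y'.
  by apply: H; rewrite leqnn andbT ltn_exp2l ?prime_gt1.
elim: m => // m IH /andP[]; rewrite ltnS leq_eqVlt => /orP[/eqP <-//|lt_m] lt_m'.
have fm : agrees m y' by apply: IH; rewrite lt_m ltnW.
have m_gt0 : (0 < m)%N by apply: leq_ltn_trans lt_m.
have [d fd] := agrees_leading fm; apply: agreesS.
rewrite -[0](leading_not_ppower m_gt0 _ fm fd) //.
rewrite ltn_neqAle dvdn_leq ?pfactor_dvdnn // andbT; apply/eqP => mE.
move: lt_m lt_m'; rewrite -mE !ltn_exp2l ?prime_gt1 // ltnS => lt_k le_k.
by rewrite leqNgt lt_k in le_k.
Qed.

Lemma endo_zp_near : exists y, is_Zp p y /\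
  forall x : ps F, x 0%N = 0 -> f (1 + s * x) = zp_pow y (1 + s * x).
Proof.
(* The agreement hypothesis sits under the existential so that [choice] yields a total digit
   function; the digit defaults to 0 where agreement fails. *)
have step (ky : nat * nat) : exists j, agrees (p ^ ky.1) ky.2 ->
    (j < p)%N /\ agrees (p ^ ky.1.+1) (ky.2 + j * p ^ ky.1).
  have [/agrees_step[j lt_j fj]|n] := pselect (agrees (p ^ ky.1) ky.2).
    by exists j.
  by exists 0%N.
have [J JP] := choice step.
pose fix y k := if k is k'.+1 then (y k' + J (k', y k') * p ^ k')%N else 0%N.
have yA k : agrees (p ^ k) (y k).
  elim: k => [|k IH]; first exact: agrees_1.
  by have [] := JP (k, y k) IH.
have yJ k : (J (k, y k) < p)%N by have [] := JP (k, y k) (yA k).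
have y_lt k : (y k < p ^ k)%N.
  elim: k => [|k IH] //=; rewrite expnS; have := yJ k; nia.
have yP : is_Zp p y.
  by move=> k; split=> //=; rewrite addnC modnMDl modn_small.
exists y; split=> // x x0; apply: (ps_eq_modp hp) => k.
apply: (@dvps_sub_trans _ _ ((1 + s * x) ^+ y k)).
  by apply: dvps_trans (yA k x x0); apply/dvps_expr/dvps_pi.
exact/dvps_subC/(zp_pow_mod hp hF)/in_U_1D.
Qed.

Lemma endo_zp : exists y, is_Zp p y /\ forall u, in_U u -> f u = zp_pow y u.
Proof.
have [y [yP fy]] := endo_zp_near; exists y; split=> // u uU.
(* Taking [k = n.+1] makes n < p^k strict. After dividing (u - 1)^(p^k) by [s] a factor [pi]
   remains, so the quotient lies in the maximal ideal. *)
have [n [r rE]] := dvps_pi_pow s0; pose k := n.+1.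
apply: (@frobenius_inj _ _ hp hF k) => /=; rewrite -endoX // -(zp_powX hp hF) //.
have /in_U_sub1/dvps_pi[w wE] := uU.
have lt_n : (n < p ^ k)%N by apply: leq_trans (leq_expp hp k).
have -> : u ^+ (p ^ k) = 1 + s * (r * pi ^+ (p ^ k - n) * w ^+ (p ^ k)).
  rewrite -[u in LHS](subrK 1) frobeniusD // expr1n addrC wE exprMn; congr (_ + _).
  by rewrite !mulrA -rE -exprD subnKC // ltnW.
by apply: fy; rewrite !coefpsM0 coefpsX0 expr0n subn_eq0 leqNgt lt_n mulr0 mul0r.
Qed.

End Endomorphism.

Theorem theorem1p1 (F : finFieldType) (p : nat) (hp : prime p) (hF : p \in [pchar F]) :
  (* y |-> (u |-> u^y) lands in Lambda *)
  (forall y, is_Zp p y -> in_Lambda (zp_pow (F := F) y)) /\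
  (* it is a homomorphism (Z_p,+) -> (Lambda, pointwise product) *)
  (forall y z, is_Zp p y -> is_Zp p z -> forall u : ps F, in_U u ->
     zp_pow (padic_add p y z) u = ps_mul (zp_pow y u) (zp_pow z u)) /\
  (* injective *)
  (forall y z, is_Zp p y -> is_Zp p z ->
     (forall u : ps F, in_U u -> zp_pow y u = zp_pow z u) -> y = z) /\
  (* surjective *)
  (forall f : ps F -> ps F, in_Lambda f ->
     exists y, is_Zp p y /\ forall u, in_U u -> f u = zp_pow y u).
Proof.
split; first by move=> y; apply: zp_pow_Lambda.
split; first by move=> y z yP zP u uU; apply: zp_powD.
split.
  move=> y z yP zP e; apply: (zp_pow_inj hp hF yP zP); apply: e; exact: in_U_1pi.
move=> f [fU [fM [_ fA]]].
(* Only the expansion at 1 is extracted; multiplicativity carries the conclusion to all of U. *)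
have [rho [/eqP rho0 [_ f_an]]] := fA 1 erefl.
have [s [a [s0 fE]]] := analytic_on_psum rho0 f_an.
exact: endo_zp fE.
Qed.
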